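(* Let $A \in M_n(\mathbb{C})$ be $R_n$-normal and let $\varepsilon > 0$ be given. Then there exists some $R_n$-normal matrix $\hat{A} \in M_n(\mathbb{C})$ with $n$ distinct eigenvalues such that $\Vert A - \hat{A} \Vert_2 < \varepsilon$.
   Context: $M_n(\mathbb{C})$ is the set of complex $n\times n$ matrices, $^H$ denotes conjugate transpose, and $\Vert\cdot\Vert_2$ is the spectral norm. $R_n$ is the $n\times n$ matrix with ones on the anti-diagonal and zeros elsewhere. For $A\in M_n(\mathbb{C})$ put $A^\star := R_n^{-1}A^HR_n = R_nA^HR_n$. $A$ is called $R_n$-normal if $AA^\star = A^\star A$. *)

(* Defs.v *)
From mathcomp Require Import all_boot all_order all_algebra.
From mathcomp Require Import boolp classical_sets reals.
From mathcomp Require Import sesquilinear spectral complex.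

Set Implicit Arguments.
Unset Strict Implicit.
Unset Printing Implicit Defensive.

Import Order.TTheory GRing.Theory Num.Theory.

Local Open Scope ring_scope.
Local Open Scope complex_scope.
Local Open Scope sesquilinear_scope.

Section FlipNormal.
Variables (R : realType) (n : nat).
Local Notation C := R[i].

Definition flipmx : 'M[C]_n := \matrix_(i, j) (j == rev_ord i)%:R.

(* [A ^t*] is the conjugate transpose. *)
Definition flip_adjoint (A : 'M[C]_n) : 'M[C]_n :=
  invmx flipmx *m A ^t* *m flipmx.

Definition flip_normal (A : 'M[C]_n) : Prop :=
  A *m flip_adjoint A = flip_adjoint A *m A.

Lemma flipmxK : flipmx *m flipmx = 1%:M.
Proof.
apply/matrixP => i j; rewrite !mxE (bigD1 (rev_ord i)) //= !mxE eqxx mul1r.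
rewrite big1 ?addr0 ?rev_ordK 1?eq_sym // => k /negbTE ki.
by rewrite !mxE ki mul0r.
Qed.

Lemma invmx_flipmx : invmx flipmx = flipmx.
Proof.
have [u _] := mulmx1_unit flipmxK.
by rewrite -[RHS](mulKmx u) flipmxK mulmx1.
Qed.

Lemma flip_adjointE (A : 'M[C]_n) :
  flip_adjoint A = flipmx *m A ^t* *m flipmx.
Proof. by rewrite /flip_adjoint invmx_flipmx. Qed.

End FlipNormal.

Section SpectralNorm.
Variable R : realType.
Local Notation C := R[i].
Local Open Scope classical_set_scope.

Definition norm2 n (x : 'cV[C]_n) : R :=
  Num.sqrt (\sum_i Normc.normc (x i 0) ^+ 2).

(* The unit ball is used instead of the unit sphere so that the set is
   nonempty when n = 0. *)
Definition spectral_norm n (A : 'M[C]_n) : R :=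
  sup [set norm2 (A *m x) | x in [set x : 'cV[C]_n | norm2 x <= 1]].

Let normc_ge0 (z : C) : 0 <= Normc.normc z.
Proof. by case: z => a b /=; apply: sqrtr_ge0. Qed.

Let norm2_ge_coord n (x : 'cV[C]_n) i : Normc.normc (x i 0) <= norm2 x.
Proof.
rewrite -[leLHS]ger0_norm // -sqrtr_sqr ler_sqrt; last first.
  by apply: sumr_ge0 => k _; apply: sqr_ge0.
by rewrite (bigD1 i) //= lerDl sumr_ge0 // => k _; apply: sqr_ge0.
Qed.

Let normc_sum (I : finType) (F : I -> C) :
  Normc.normc (\sum_i F i) <= \sum_i Normc.normc (F i).
Proof.
elim/big_ind2 : _ => [|a b c d ab cd|//]; first by rewrite Normc.normc0.
by apply: le_trans (lerD ab cd); apply: le_normcD.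
Qed.

Lemma spectral_norm_has_sup n (A : 'M[C]_n) :
  has_sup [set norm2 (A *m x) | x in [set x : 'cV[C]_n | norm2 x <= 1]].
Proof.
split.
  exists (norm2 (A *m 0)), 0 => //=.
  rewrite /norm2 big1 ?sqrtr0 // => i _.
  by rewrite mxE Normc.normc0 expr0n.
exists (Num.sqrt (\sum_i (\sum_j Normc.normc (A i j)) ^+ 2)) => _ [x /= x1 <-].
rewrite /norm2 ler_sqrt; last by apply: sumr_ge0 => i _; apply: sqr_ge0.
apply: ler_sum => i _; rewrite ler_sqr ?nnegrE ?sumr_ge0 // mxE.
apply: le_trans (normc_sum _) _; apply: ler_sum => j _.
rewrite Normc.normcM ler_piMr //.
exact: le_trans (norm2_ge_coord x j) x1.
Qed.

End SpectralNorm.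

(* Main.v *)
Require Import Defs.
From mathcomp Require Import all_boot all_order all_algebra separable.
From mathcomp Require Import boolp classical_sets reals.
From mathcomp Require Import sesquilinear spectral complex zify ring.

Import Order.TTheory GRing.Theory Num.Theory.

Local Open Scope ring_scope.
Local Open Scope complex_scope.

(** Every R-normal [A], with R the flip matrix, is [H + S] with [H] self-adjoint
    and [S] anti-self-adjoint for the flip adjoint; R-normality says that [H]
    and [S] commute.  If [A] happened to be a polynomial [q] in one
    self-adjoint matrix [H'], a perturbation would be easy: every polynomial
    in a self-adjoint matrix is R-normal, because its adjoint is a polynomial
    in the same matrix, so both [H'] and [q] may be moved freely.  The proof
    first reaches this situation and then perturbs.

    To reach it, keep [S] and move [H] inside the commutant of [S] until it
    has a cyclic vector; then [H + S], which commutes with it, is a polynomial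
    in it ([commute_cyclic_horner]).  Having [v] as a cyclic vector is the
    nonvanishing of one determinant, hence an open condition that holds at
    all but finitely many points of a line as soon as it holds at one complex
    point ([cyclic_vector_line]).  So a single cyclic matrix commuting with
    [S] is enough.  It need not even be self-adjoint: the commutant of [S] is
    stable under the adjoint, so a commuting cyclic matrix is [X + i Y] with
    [X], [Y] self-adjoint in the commutant, and [X + s Y] is cyclic for some
    real [s] ([exists_cyclic_selfadjoint]).

    That every complex matrix commutes with a cyclic one
    ([exists_commuting_cyclic]) comes from splitting off a maximal cyclic
    summand ([cyclic_summand]) and repeating on the complement; on the direct
    sum one uses the given matrix on the first summand and a matrix obtained
    by induction on the second, shifted by a scalar that makes the two
    characteristic polynomials coprime.

    For the second perturbation, join the pair [(H', q)] by a line to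
    [(D, 'X)], where [D] is a self-adjoint diagonal matrix with distinct
    entries.  Along it, the determinant of the derivative of the
    characteristic polynomial evaluated at the matrix itself is a polynomial
    in the parameter; it vanishes when there is a multiple eigenvalue and not
    at the end point, so eigenvalues are distinct for arbitrarily small real
    parameters ([approx_distinct_eigenvalues]). *)

(** * Polynomials in a matrix and cyclic vectors *)

Definition cyclic_vector {F : fieldType} {n} (N : 'M[F]_n.+1) (v : 'rV_n.+1) :=
  forall u : 'rV_n.+1, exists p, u = v *m horner_mx N p.

Lemma horner_mx_sum {R : comNzRingType} {n} (A : 'M[R]_n.+1) d (p : {poly R}) :
  (size p <= d)%N -> horner_mx A p = \sum_(i < d) p`_i *: A ^+ i.
Proof.
move=> le_pd; rewrite -{1}[p]coefK poly_def.
rewrite (big_ord_widen_cond _ xpredT (fun i => p`_i *: 'X^i) le_pd) /=.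
rewrite linear_sum [RHS](bigID (fun i : 'I_d => (i < size p)%N)) /=.
rewrite [X in _ + X]big1 ?addr0 => [|i]; last first.
  by rewrite -leqNgt => /(nth_default 0) ->; rewrite scale0r.
by apply: eq_bigr => i _; rewrite linearZ /= rmorphXn /= horner_mx_X.
Qed.

Lemma horner_mx_intertwine {R : comNzRingType} {m n} (X : 'M[R]_(m.+1, n.+1))
    (M : 'M_m.+1) (N : 'M_n.+1) p :
  X *m N = M *m X -> X *m horner_mx N p = horner_mx M p *m X.
Proof.
move=> XN; elim/poly_ind: p => [|p c IHp].
  by rewrite !rmorph0 mulmx0 mul0mx.
rewrite !rmorphD !rmorphM /= !horner_mx_X !horner_mx_C mulmxDr mulmxDl.
by rewrite -!mulmxE mulmxA IHp -!mulmxA XN mul_mx_scalar mul_scalar_mx.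
Qed.

(** A vector of the form [(1, t, t ^ 2, ...)] works for all but finitely many
    [t]: its product with a nonzero column is a nonzero polynomial in [t]. *)
Lemma common_nonkernel {F : closedFieldType} {n} (Ms : seq 'M[F]_n) :
  all (fun M => M != 0) Ms ->
  exists v : 'rV_n, all (fun M => v *m M != 0) Ms.
Proof.
move=> Ms_neq0.
suff [g g_neq0 gP]: exists2 g : {poly F}, g != 0 &
    forall t, ~~ root g t -> all (fun M => (\row_i t ^+ i) *m M != 0) Ms.
  have /closed_nonrootP [t /gP] := g_neq0.
  by exists (\row_i t ^+ i).
elim: Ms Ms_neq0 => [|M Ms IHMs] /=; first by exists 1; rewrite ?oner_eq0.
case/andP=> /matrix0Pn [i [j Mij]] /IHMs [g g_neq0 gP].
pose h : {poly F} := rVpoly (row j M^T).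
exists (h * g) => [|t].
  rewrite mulf_neq0 //; apply: contraNneq Mij => h0.
  by have := coef_rVpoly_ord (row j M^T) i; rewrite -/h h0 coef0 !mxE => <-.
rewrite rootM negb_or => /andP[ht /gP ->]; rewrite andbT.
apply: contraNneq ht => /matrixP/(_ 0 j).
rewrite !mxE /root => <-; rewrite /h (horner_coef_wide _ (size_poly _ _)).
by apply/eqP/eq_bigr => k _; rewrite coef_rVpoly_ord !mxE mulrC.
Qed.

(** The annihilator of [v] is generated by a divisor of the minimal polynomial
    [p].  It is [p] itself unless it divides [p %/ ('X - z%:P)] for some root
    [z] of [p], so it suffices that [v] avoid the kernels of the finitely many
    nonzero matrices [(p %/ ('X - z%:P))(K)]. *)
Lemma exists_minpoly_vector {F : closedFieldType} {n} (K : 'M[F]_n.+1) :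
  exists v : 'rV_n.+1, forall r, v *m horner_mx K r = 0 -> mxminpoly K %| r.
Proof.
set p := mxminpoly K.
have p_neq0 : p != 0 by rewrite monic_neq0 ?mxminpoly_monic.
have [rs def_p] := closed_field_poly_normal p.
rewrite (monicP (mxminpoly_monic K)) scale1r in def_p.
pose q z := p %/ ('X - z%:P).
have pE z : root p z -> p = q z * ('X - z%:P).
  by move=> pz; rewrite divpK // dvdp_XsubCl.
have q_neq0 z : z \in rs -> horner_mx K (q z) != 0.
  move=> rs_z; have /pE pz : root p z by rewrite -/p def_p root_prod_XsubC.
  rewrite -dvd_mxminpoly -/p gtNdvdp //.
    by apply: contraNneq p_neq0 => qz0; rewrite pz qz0 mul0r.
  rewrite pz size_mul ?polyXsubC_eq0 //; last first.
    by apply: contraNneq p_neq0 => qz0; rewrite pz qz0 mul0r.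
  by rewrite size_XsubC addn2.
have [|v /allP v_q] := common_nonkernel [seq horner_mx K (q z) | z <- rs].
  by apply/allP => _ /mapP[z /q_neq0 ? ->].
exists v => r vr0; pose g := gcdp r p.
have vg0 : v *m horner_mx K g = 0.
  have [[a b] /= /eqpP [[c1 c2] /= /andP[c1_neq0 c2_neq0] eq_g]] := Bezoutp r p.
  have : v *m horner_mx K (c2 *: g) = 0.
    rewrite -eq_g linearZ /= rmorphD (mulrC a) !rmorphM /= mx_root_minpoly mulr0.
    by rewrite addr0 -mulmxE -scalemxAr mulmxA vr0 mul0mx scaler0.
  rewrite linearZ /= -scalemxAr => /eqP.
  by rewrite scaler_eq0 (negPf c2_neq0) => /eqP.
have g_dvd_p : g %| p by apply: dvdp_gcdr.
have def_ph : p = (p %/ g) * g by rewrite divpK.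
have [size1|/closed_rootP[z hz]] := eqVneq (size (p %/ g)) 1%N.
  have h1 : p %/ g %= 1 by rewrite -size_poly_eq1 size1.
  have pg : p %= g by have := eqp_mulr g h1; rewrite mul1r -def_ph.
  by rewrite (eqp_dvdl _ pg) dvdp_gcdl.
have pz : root p z by rewrite def_ph rootM hz.
have /v_q /negP[] : horner_mx K (q z) \in [seq horner_mx K (q z) | z <- rs].
  by apply: map_f; rewrite -root_prod_XsubC -def_p.
have -> : q z = g * ((p %/ g) %/ ('X - z%:P)).
  by rewrite /q {1}def_ph mulrC -divp_mulA ?dvdp_XsubCl.
by rewrite rmorphM /= -mulmxE mulmxA vg0 mul0mx.
Qed.

Lemma horner_mx_powers_minpoly {F : fieldType} {n} (K : 'M[F]_n.+1) p :
  exists c : 'I_(degree_mxminpoly K) -> F,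
    horner_mx K p = \sum_i c i *: K ^+ i.
Proof.
exists (fun i => (p %% mxminpoly K)`_i).
rewrite -(horner_mx_sum K _ _ (size_mod_mxminpoly K p)).
rewrite {1}(divp_eq p (mxminpoly K)) rmorphD rmorphM /= mx_root_minpoly.
by rewrite mulr0 add0r.
Qed.

(** A cyclic subspace of maximal dimension has an invariant complement.  Take
    [v] with annihilator the minimal polynomial, of degree [d], and a linear
    form [w] that vanishes on [v K ^ i] for [i < d - 1] and takes the value
    [1] at [v K ^ (d - 1)].  The common kernel of the forms [K ^ j w] with
    [j < d] is invariant, and it meets the span of the [v K ^ i] trivially as
    the matrix of the values [v K ^ (i + j) w] is triangular up to the order
    of its columns.

    The complement is presented by the rows of [B], with [C] giving
    coordinates on it; [C *m B] is the projection onto it along the kernel of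
    [C], which is the cyclic subspace. *)
Lemma cyclic_summand {F : closedFieldType} {n} (K : 'M[F]_n.+1) :
  exists m (v : 'rV_n.+1) (B : 'M_(m, n.+1)) (C : 'M_(n.+1, m)),
    [/\ (m < n.+1)%N, B *m C = 1%:M, K *m (C *m B) = (C *m B) *m K, v *m C = 0 &
        forall u : 'rV_n.+1, u *m C = 0 -> exists p, u = v *m horner_mx K p].
Proof.
have [v v_minpoly] := exists_minpoly_vector K.
set d := degree_mxminpoly K.
have d_gt0 : (0 < d)%N := mxminpoly_nonconstant K.
pose V : 'M_(d, n.+1) := \matrix_(i < d) (v *m K ^+ i).
have rowV (c : 'rV_d) : c *m V = v *m horner_mx K (rVpoly c).
  rewrite (horner_mx_sum K _ _ (size_poly _ _)) mulmx_sumr mulmx_sum_row.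
  by apply: eq_bigr => i _; rewrite rowK coef_rVpoly_ord scalemxAr.
have freeV : row_free V.
  apply: inj_row_free => c; rewrite rowV => /v_minpoly dvd_c.
  apply: (can_inj rVpolyK); rewrite linear0; apply/eqP.
  apply: contraTT dvd_c => c_neq0.
  by rewrite gtNdvdp // size_mxminpoly ltnS size_poly.
pose w : 'cV_n.+1 := pinvmx V *m delta_mx (rev_ord (Ordinal d_gt0)) 0.
have vKw (i : 'I_d) : (v *m K ^+ i *m w) 0 0 = (i == rev_ord (Ordinal d_gt0))%:R.
  have -> : v *m K ^+ i = row i V by rewrite rowK.
  by rewrite -row_mul /w mulmxA mulmxVp // mul1mx !mxE eqxx andbT.
(* The powers are listed in decreasing order so that [V *m W] is lower
   triangular with ones on the diagonal. *)
pose W : 'M_(n.+1, d) := \matrix_(i, j) (K ^+ (rev_ord j) *m w) i 0.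
have colW j : col j W = K ^+ (rev_ord j) *m w.
  by apply/matrixP => i k; rewrite !mxE ord1.
have unitVW : V *m W \in unitmx.
  have VWE i j : (V *m W) i j = (v *m K ^+ (i + rev_ord j) *m w) 0 0.
    have -> : (V *m W) i j = (row i V *m col j W) 0 0.
      by rewrite !mxE; apply: eq_bigr => k _; rewrite !mxE.
    by rewrite rowK colW exprD -mulmxE !mulmxA.
  rewrite unitmxE det_trig; last first.
    apply/is_trig_mxP => i j lt_ij.
    have lt_d : (i + rev_ord j < d)%N by rewrite /=; have := ltn_ord j; lia.
    rewrite VWE (vKw (Ordinal lt_d)) -val_eqE /= ltn_eqF //.
    by have := ltn_ord j; lia.
  rewrite big1 ?unitr1 // => i _.
  have lt_d : (i + rev_ord i < d)%N by rewrite /=; have := ltn_ord i; lia.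
  rewrite VWE (vKw (Ordinal lt_d)) -val_eqE /=.
  by have -> : (i + (d - i.+1) == d - 1)%N by have := ltn_ord i; lia.
pose M := invmx (V *m W).
have memV p : exists c, v *m horner_mx K p = c *m V.
  have [c ->] := horner_mx_powers_minpoly K p.
  exists (\row_i c i); rewrite mulmx_sumr mulmx_sum_row.
  by apply: eq_bigr => i _; rewrite rowK mxE scalemxAr.
have [Y VK] : exists Y, V *m K = Y *m V.
  suff /submxP[Y ->] : (V *m K <= V)%MS by exists Y.
  apply/row_subP => i; rewrite row_mul rowK -mulmxA.
  have -> : K ^+ i *m K = horner_mx K ('X ^+ i.+1).
    by rewrite rmorphXn /= horner_mx_X exprSr.
  by have [c ->] := memV ('X ^+ i.+1); apply: submxMl.
have [X KW] : exists X, K *m W = W *m X.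
  suff /submxP[X /(congr1 trmx)] : ((K *m W)^T <= W^T)%MS.
    by rewrite trmxK trmx_mul trmxK => ->; exists X^T.
  apply/row_subP => j; rewrite -tr_col.
  rewrite colE -mulmxA -colE colW mulmxA.
  have -> : K *m K ^+ rev_ord j = horner_mx K ('X ^+ (rev_ord j).+1).
    by rewrite rmorphXn /= horner_mx_X exprS.
  have [c ->] := horner_mx_powers_minpoly K ('X ^+ (rev_ord j).+1).
  rewrite mulmx_suml linear_sum summx_sub // => i _.
  rewrite -scalemxAl linearZ /= scalemx_sub //.
  by rewrite -(rev_ordK i) -colW tr_col row_sub.
have MYX : M *m Y = X *m M.
  rewrite -[LHS](mulmxK unitVW) -/M; congr (_ *m M).
  by rewrite -!mulmxA (mulmxA Y) -VK -(mulmxA V) KW (mulmxA V) /M mulKmx.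
(* [W *m M *m V] projects onto the cyclic subspace along the kernel of [W]. *)
pose E := 1%:M - W *m M *m V.
have WMVK : W *m M *m V *m K = K *m (W *m M *m V).
  by rewrite -mulmxA VK !mulmxA KW -!mulmxA [M *m _]mulmxA MYX !mulmxA.
have vV : v = row (Ordinal d_gt0) V by rewrite rowK expr0 mulmx1.
have VE : V *m E = 0.
  by rewrite mulmxBr mulmx1 !mulmxA mulmxV // mul1mx subrr.
have EE : E *m E = E.
  by rewrite {1}/E mulmxBl mul1mx -(mulmxA _ V) VE mulmx0 subr0.
have vE : v *m E = 0 by rewrite vV -row_mul VE row0.
(* A rank factorization of an idempotent gives coordinates on its image. *)
have [B [C [CB fullC freeB]]] : exists B (C : 'M_(_, \rank E)),
    [/\ C *m B = E, row_full C & row_free B].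
  exists (row_base E), (col_base E).
  by rewrite mulmx_base col_base_full row_base_free.
exists (\rank E), v, B, C; split.
- rewrite ltn_neqAle rank_leq_row andbT; apply/negP => freeE.
  have v0 : v = 0 by apply: (row_free_inj freeE); rewrite /= vE mul0mx.
  have /v_minpoly : v *m horner_mx K 1 = 0 by rewrite v0 mul0mx.
  by rewrite dvdp1 size_mxminpoly eqSS -/d eqn0Ngt d_gt0.
- apply: (row_full_inj fullC); apply: (row_free_inj freeB).
  by rewrite /= mulmx1 !mulmxA CB -mulmxA CB EE.
- by rewrite CB mulmxBr mulmxBl mulmx1 mul1mx WMVK.
- by apply: (row_free_inj freeB); rewrite /= -mulmxA CB vE mul0mx.
move=> u uC; have : u *m E = 0 by rewrite -CB mulmxA uC mul0mx.
rewrite mulmxBr mulmx1 => /eqP; rewrite subr_eq0 => /eqP ->.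
by rewrite !mulmxA rowV; eexists.
Qed.

Lemma cyclic_vector_shift {F : fieldType} {n} (N : 'M[F]_n.+1) v c :
  cyclic_vector N v -> cyclic_vector (N + c%:M) v.
Proof.
move=> cycN u; have [p ->] := cycN u; exists (p \Po ('X - c%:P)); congr (_ *m _).
elim/poly_ind: p => [|p a IHp]; first by rewrite comp_poly0 !rmorph0.
rewrite comp_poly_MXaddC !rmorphD !rmorphM /= -IHp rmorphB /= !horner_mx_X.
by rewrite !horner_mx_C addrK.
Qed.

(** The roots of the shifted characteristic polynomial are the shifted
    eigenvalues, so only the finitely many differences [x - y], with [x] a root
    of [p] and [y] an eigenvalue of [N], are excluded. *)
Lemma coprimep_char_poly_shift {F : closedFieldType} {n} (N : 'M[F]_n.+1) p :
  p != 0 -> exists c, coprimep p (char_poly (N + c%:M)).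
Proof.
move=> p_neq0; have [rs def_p] := closed_field_poly_normal p.
have [ms def_N] := closed_field_poly_normal (char_poly N).
have memr (q : {poly F}) s x : q != 0 ->
    q = lead_coef q *: \prod_(z <- s) ('X - z%:P) -> root q x = (x \in s).
  by move=> q_neq0 ->; rewrite rootZ ?lead_coef_eq0 // root_prod_XsubC.
pose bad := [seq x - y | x <- rs, y <- ms].
have /closed_nonrootP[c] : \prod_(z <- bad) ('X - z%:P) != 0.
  by rewrite monic_neq0 ?monic_prod_XsubC.
rewrite root_prod_XsubC => c_good; exists c.
apply: Pdiv.ClosedField.root_coprimep => x px; apply: contra c_good => Nx.
have : eigenvalue (N + c%:M) x by rewrite eigenvalue_root_char.
case/eigenvalueP => v vN v_neq0.
have : eigenvalue N (x - c).
  apply/eigenvalueP; exists v => //; move: vN.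
  by rewrite mulmxDr mul_mx_scalar scalerBl => <-; rewrite addrK.
rewrite eigenvalue_root_char (memr _ _ _ _ def_N) ?monic_neq0 ?char_poly_monic //.
move=> ms_x; apply/allpairsP; exists (x, x - c).
by rewrite -(memr _ _ _ p_neq0 def_p) subKr.
Qed.

(** On a direct sum of two invariant subspaces whose annihilating polynomials
    are coprime, the sum of two cyclic vectors is cyclic, by the Chinese
    remainder theorem.  When the complement of [cyclic_summand] is zero, [K]
    is itself cyclic. *)
Lemma exists_commuting_cyclic {F : closedFieldType} {n} (K : 'M[F]_n.+1) :
  exists N v, K *m N = N *m K /\ cyclic_vector N v.
Proof.
have [k] := ubnP n; elim: k => // k IHk in n K *; rewrite ltnS => le_nk.
have [[|m] [v [B [C [lt_m BC KCB vC v_gen]]]]] := cyclic_summand K.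
  by exists K, v; split=> // u; apply: v_gen; rewrite thinmx0.
have lt_mk : (m < k)%N := leq_trans (lt_m : (m < n)%N) le_nk.
have [N0 [v0 [KN0 cycN0]]] := IHk m (B *m K *m C) lt_mk.
have p_neq0 : mxminpoly K != 0 by rewrite monic_neq0 ?mxminpoly_monic.
have [c cop_c] := coprimep_char_poly_shift N0 _ p_neq0.
pose N1 := N0 + c%:M; have cycN1 := cyclic_vector_shift N0 v0 c cycN0.
have KN1 : B *m K *m C *m N1 = N1 *m (B *m K *m C).
  by rewrite mulmxDr mulmxDl KN0 mul_mx_scalar mul_scalar_mx.
pose E := 1%:M - C *m B.
have KE : K *m E = E *m K by rewrite mulmxBl mulmxBr KCB mul1mx mulmx1.
have BE : B *m E = 0 by rewrite mulmxBr mulmx1 mulmxA BC mul1mx subrr.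
have EC : E *m C = 0 by rewrite mulmxBl mul1mx -mulmxA BC mulmx1 subrr.
have EE : E *m E = E by rewrite {1}/E mulmxBl mul1mx -mulmxA BE mulmx0 subr0.
(* [N] acts as [K] on the cyclic summand and as [N1] on its complement. *)
pose N := E *m K + C *m N1 *m B.
have BN : B *m N = N1 *m B.
  by rewrite mulmxDr !mulmxA BE mul0mx add0r BC mul1mx.
have EN : E *m N = K *m E.
  by rewrite mulmxDr !mulmxA EC !mul0mx addr0 EE KE.
have KC : K *m C = C *m (B *m K *m C).
  by rewrite !mulmxA -KCB -!mulmxA BC mulmx1.
have BK : B *m K = B *m K *m C *m B.
  by rewrite -!mulmxA KCB !mulmxA BC mul1mx.
exists N, (v + v0 *m B); split.
  rewrite /N mulmxDr [RHS]mulmxDl; congr (_ + _); first by rewrite mulmxA KE.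
  rewrite -(mulmxA _ B) BK !mulmxA KC -!mulmxA; congr (C *m _).
  by move: KN1; rewrite -!mulmxA => /(congr1 (mulmxr B)) /=; rewrite -!mulmxA.
move=> u.
have [|p1 p1E] := v_gen (u *m E); first by rewrite -mulmxA EC mulmx0.
have [p2 p2E] := cycN1 (u *m C).
have /Bezout_eq1_coprimepP[[a b] /= ab1] := cop_c.
set f1 := mxminpoly K in ab1 *; set f2 := char_poly _ in ab1 *.
(* The Chinese remainder solution: congruent to [p1] modulo [f1] and to [p2]
   modulo [f2]. *)
pose p := p1 * (b * f2) + p2 * (a * f1).
have pK : horner_mx K p = horner_mx K p1.
  have -> : p = p1 + (p2 - p1) * a * f1.
    by rewrite /p -[b * f2](addKr (a * f1)) ab1; ring.
  by rewrite rmorphD rmorphM /= mx_root_minpoly mulr0 addr0.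
have pN1 : horner_mx N1 p = horner_mx N1 p2.
  have -> : p = p2 + (p1 - p2) * b * f2.
    by rewrite /p -[a * f1](addrK (b * f2)) ab1; ring.
  by rewrite rmorphD rmorphM /= Cayley_Hamilton mulr0 addr0.
exists p.
have vE : v *m E = v by rewrite mulmxBr mulmx1 mulmxA vC mul0mx subr0.
rewrite mulmxDl -mulmxA (horner_mx_intertwine _ _ _ _ BN) pN1 mulmxA -p2E.
rewrite -{1}vE -(mulmxA v) (horner_mx_intertwine _ _ _ _ EN) pK mulmxA -p1E.
by rewrite -!mulmxA EE mulmxBr mulmx1 subrK.
Qed.

(** * Cyclicity as an open condition *)

Definition krylov_mx {R : nzRingType} {n} (v : 'rV[R]_n.+1) (N : 'M_n.+1) :=
  \matrix_(i < n.+1) (v *m N ^+ i).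

Lemma mul_krylov_mx {R : comNzRingType} {n} (v : 'rV[R]_n.+1) (N : 'M_n.+1) c :
  c *m krylov_mx v N = v *m horner_mx N (rVpoly c).
Proof.
rewrite (horner_mx_sum N _ _ (size_poly _ _)) mulmx_sumr mulmx_sum_row.
by apply: eq_bigr => i _; rewrite rowK coef_rVpoly_ord scalemxAr.
Qed.

(** By the Cayley-Hamilton theorem, polynomials of degree less than the
    dimension suffice to reach every vector. *)
Lemma cyclic_vectorP {F : fieldType} {n} (N : 'M[F]_n.+1) (v : 'rV_n.+1) :
  cyclic_vector N v <-> \det (krylov_mx v N) != 0.
Proof.
rewrite -unitfE -unitmxE; split=> [cycN|unitN u]; last first.
  by exists (rVpoly (u *m invmx (krylov_mx v N))); rewrite -mul_krylov_mx mulmxKV.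
rewrite -row_full_unit -sub1mx; apply/row_subP => i.
have [p ->] := cycN (row i 1%:M).
have size_mod : (size (p %% char_poly N)%R <= n.+1)%N.
  rewrite -ltnS -[X in (_ < X)%N](size_char_poly N) ltn_modp.
  by rewrite monic_neq0 ?char_poly_monic.
rewrite (divp_eq p (char_poly N)) rmorphD rmorphM /= Cayley_Hamilton mulr0 add0r.
by rewrite -(poly_rV_K size_mod) -mul_krylov_mx submxMl.
Qed.

(** A matrix commuting with [N] is determined by its value at a cyclic vector,
    and some polynomial in [N] has the same value there. *)
Lemma commute_cyclic_horner {F : fieldType} {n} (N A : 'M[F]_n.+1) v :
  cyclic_vector N v -> A *m N = N *m A -> exists p, A = horner_mx N p.
Proof.
move=> cycN AN; have [p vA] := cycN (v *m A); exists p.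
apply/row_matrixP => i; have [q qE] := cycN (delta_mx 0 i).
rewrite !rowE qE -!mulmxA -(horner_mx_intertwine A N N q AN) [LHS]mulmxA vA -mulmxA.
by congr (_ *m _); apply: comm_horner_mx2.
Qed.

Lemma map_krylov_mx {aR rR : comNzRingType} (f : {rmorphism aR -> rR}) {n}
    (v : 'rV_n.+1) N :
  map_mx f (krylov_mx v N) = krylov_mx (map_mx f v) (map_mx f N).
Proof.
by apply/row_matrixP => i; rewrite -map_row !rowK map_mxM rmorphXn.
Qed.

(** The point of parameter ['X] on the line through [X] directed by [Y]. *)
Definition line_mx {F : comNzRingType} {n} (X Y : 'M[F]_n) : 'M[{poly F}]_n :=
  map_mx polyC X + 'X *: map_mx polyC Y.

Lemma map_line_mx {F : comNzRingType} {n} (X Y : 'M[F]_n) s :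
  map_mx (horner_eval s) (line_mx X Y) = X + s *: Y.
Proof.
by apply/matrixP => i j; rewrite !mxE /horner_eval hornerD hornerM hornerX !hornerC.
Qed.

Lemma cyclic_vector_line {F : fieldType} {n} (X Y : 'M[F]_n.+1) v s0 :
  cyclic_vector (X + s0 *: Y) v ->
  exists2 f : {poly F}, f != 0 &
    forall s, ~~ root f s -> cyclic_vector (X + s *: Y) v.
Proof.
pose f := \det (krylov_mx (map_mx polyC v) (line_mx X Y)).
have fE s : f.[s] = \det (krylov_mx v (X + s *: Y)).
  rewrite -horner_evalE -det_map_mx map_krylov_mx map_line_mx -map_mx_comp.
  rewrite (_ : map_mx _ v = v) //; apply/matrixP => i j.
  by rewrite mxE /= /horner_eval hornerC.
move=> /cyclic_vectorP f_s0; exists f => [|s fs].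
  by apply: contraNneq f_s0 => f0; rewrite -fE f0 horner0.
by apply/cyclic_vectorP; rewrite -fE.
Qed.

Lemma eigenvector_horner_mx {F : fieldType} {n} (A : 'M[F]_n.+1)
    (u : 'rV_n.+1) a p :
  u *m A = a *: u -> u *m horner_mx A p = p.[a] *: u.
Proof.
move=> uA; elim/poly_ind: p => [|p c IHp].
  by rewrite rmorph0 horner0 mulmx0 scale0r.
rewrite rmorphD rmorphM /= horner_mx_X horner_mx_C mulmxDr -mulmxE mulmxA IHp.
by rewrite -scalemxAl uA mul_mx_scalar scalerA -scalerDl hornerMXaddC.
Qed.

(** * Detecting distinct eigenvalues *)

(** Over an algebraically closed field this is, up to sign, the discriminant of
    the characteristic polynomial: the product of its derivative over the
    eigenvalues.  In this form it commutes with ring morphisms. *)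
Definition simple_spectrum_det {R : comNzRingType} {n} (A : 'M[R]_n.+1) : R :=
  \det (horner_mx A (char_poly A)^`()).

Lemma map_simple_spectrum_det {aR rR : comNzRingType}
    (f : {rmorphism aR -> rR}) {n} (A : 'M_n.+1) :
  f (simple_spectrum_det A) = simple_spectrum_det (map_mx f A).
Proof. by rewrite -det_map_mx map_horner_mx -deriv_map map_char_poly. Qed.

(** An eigenvector for a multiple root of the characteristic polynomial is
    killed by the derivative evaluated at [A]. *)
Lemma distinct_eigenvalues {F : closedFieldType} {n} (A : 'M[F]_n.+1) :
  simple_spectrum_det A != 0 ->
  exists s : seq F,
    [/\ uniq s, size s = n.+1 & forall z, (z \in s) = eigenvalue A z].
Proof.
rewrite -unitfE -unitmxE => unitA.
have [s] := closed_field_poly_normal (char_poly A).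
rewrite (monicP (char_poly_monic A)) scale1r => def_s.
exists s; split=> [||z].
- rewrite -separable_prod_XsubC -def_s unlock.
  apply: Pdiv.ClosedField.root_coprimep => x.
  rewrite -eigenvalue_root_char => /eigenvalueP [u uA u_neq0].
  apply: contraNneq u_neq0 => x_root.
  rewrite -(mulmxK unitA u) (eigenvector_horner_mx _ _ _ _ uA).
  by rewrite x_root scale0r mul0mx.
- by apply/eqP; rewrite -eqSS -(size_char_poly A) def_s size_prod_XsubC.
- by rewrite eigenvalue_root_char def_s root_prod_XsubC.
Qed.

Lemma simple_spectrum_det_diag {F : closedFieldType} {n} (d : 'rV[F]_n.+1) :
  injective (d 0) -> simple_spectrum_det (diag_mx d) != 0.
Proof.
move=> inj_d; rewrite /simple_spectrum_det.
have -> : char_poly (diag_mx d) =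
    \prod_(z <- [seq d 0 i | i <- enum 'I_n.+1]) ('X - z%:P).
  rewrite char_poly_trig ?diag_mx_is_trig // big_map big_enum.
  by apply: eq_bigr => i _; rewrite !mxE eqxx.
set p := \prod_(z <- _) _.
have sep_p : separable_poly p.
  by rewrite separable_prod_XsubC map_inj_uniq ?enum_uniq.
rewrite unlock in sep_p.
rewrite horner_mx_diag det_diag prodf_seq_neq0; apply/allP => i _ /=.
rewrite mxE; apply: (coprimep_root sep_p).
by rewrite root_prod_XsubC map_f ?mem_enum.
Qed.

(** * The flip adjoint *)

Section FlipAdjoint.
Context {R : realType} {n : nat}.
Local Notation C := R[i].
Implicit Types (A B H X Y : 'M[C]_n.+1) (a : C) (p : {poly C}).

Lemma flip_adjointD A B : flip_adjoint (A + B) = flip_adjoint A + flip_adjoint B.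
Proof. by rewrite /flip_adjoint linearD map_mxD mulmxDr mulmxDl. Qed.

Lemma flip_adjointZ a A : flip_adjoint (a *: A) = Num.conj a *: flip_adjoint A.
Proof. by rewrite /flip_adjoint linearZ map_mxZ -scalemxAr -scalemxAl. Qed.

Lemma flip_adjointN A : flip_adjoint (- A) = - flip_adjoint A.
Proof. by rewrite -scaleN1r flip_adjointZ rmorphN1 scaleN1r. Qed.

Lemma flip_adjointM A B : flip_adjoint (A *m B) = flip_adjoint B *m flip_adjoint A.
Proof.
rewrite !flip_adjointE trmx_mul map_mxM !mulmxA.
by rewrite -(mulmxA _ (flipmx R _) (flipmx R _)) flipmxK mulmx1.
Qed.

Lemma flip_adjointK A : flip_adjoint (flip_adjoint A) = A.
Proof.
have tr_flip : (flipmx R n.+1)^T = flipmx R n.+1.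
  apply/matrixP => i j; rewrite !mxE; congr (_%:R).
  by rewrite -(inj_eq rev_ord_inj) rev_ordK eq_sym.
have conj_flip : map_mx Num.conj (flipmx R n.+1) = flipmx R n.+1.
  by apply/matrixP => i j; rewrite !mxE rmorph_nat.
rewrite !flip_adjointE !trmx_mul !map_mxM tr_flip conj_flip !mulmxA flipmxK mul1mx.
by rewrite trmxCK -mulmxA flipmxK mulmx1.
Qed.

Lemma flip_adjoint_scalar a : flip_adjoint (a%:M : 'M_n.+1) = (Num.conj a)%:M.
Proof.
rewrite flip_adjointE tr_scalar_mx map_scalar_mx mul_mx_scalar -scalemxAl flipmxK.
by rewrite scalemx1.
Qed.

Lemma flip_adjoint_horner A p :
  flip_adjoint (horner_mx A p) = horner_mx (flip_adjoint A) (map_poly Num.conj p).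
Proof.
elim/poly_ind: p => [|p a IHp].
  by rewrite !rmorph0 -(scale0r 0) flip_adjointZ rmorph0 !scale0r.
rewrite !rmorphD !rmorphM /= map_polyX map_polyC !horner_mx_X !horner_mx_C.
rewrite flip_adjointD flip_adjoint_scalar flip_adjointM IHp; congr (_ + _).
exact/esym/comm_horner_mx.
Qed.

(** The adjoint of [p(H)] is [p^*(H)], with [p^*] the conjugate polynomial. *)
Lemma flip_normal_horner H p : flip_adjoint H = H -> flip_normal (horner_mx H p).
Proof.
by move=> HH; rewrite /flip_normal flip_adjoint_horner HH; apply: comm_horner_mx2.
Qed.

Lemma flip_adjoint_real_line X Y (s : R) :
  flip_adjoint X = X -> flip_adjoint Y = Y ->
  flip_adjoint (X + s%:C *: Y) = X + s%:C *: Y.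
Proof.
move=> XX YY; rewrite flip_adjointD flip_adjointZ XX YY; congr (_ + _ *: _).
by rewrite conj_Creal // complex_real.
Qed.

(** The adjoint of a diagonal matrix has the conjugate entries in reverse
    order, so self-adjointness asks that reversal be conjugation.  Imaginary
    entries that are odd under reversal have this property, and [j - rev j]
    increases with [j]. *)
Definition flip_diag : 'rV[C]_n.+1 :=
  \row_j ('i * ((j : nat)%:R - (rev_ord j : nat)%:R)).

Lemma flip_diag_inj : injective (flip_diag 0).
Proof.
move=> j k; rewrite !mxE => /(mulfI (neq0Ci _)) /eqP.
rewrite subr_eq addrAC eq_sym subr_eq -!natrD eqr_nat /= => /eqP jk.
by apply: ord_inj; have := ltn_ord j; have := ltn_ord k; lia.
Qed.

Lemma flip_adjoint_coef A i j :
  flip_adjoint A i j = Num.conj (A (rev_ord j) (rev_ord i)).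
Proof.
rewrite flip_adjointE mxE (bigD1 (rev_ord j)) //= big1 => [|k kj]; last first.
  have /negPf jk : j != rev_ord k by rewrite -(inj_eq rev_ord_inj) rev_ordK eq_sym.
  by rewrite [X in _ * X]mxE jk mulr0.
rewrite addr0 [X in _ * X]mxE rev_ordK eqxx mulr1 mxE (bigD1 (rev_ord i)) //=.
rewrite big1 => [|k /negPf ki]; last by rewrite mxE ki mul0r.
by rewrite addr0 !mxE eqxx mul1r.
Qed.

Lemma flip_adjoint_diag : flip_adjoint (diag_mx flip_diag) = diag_mx flip_diag.
Proof.
apply/matrixP => i j; rewrite flip_adjoint_coef !mxE (inj_eq rev_ord_inj) eq_sym.
have [<-|_] := eqVneq; last by rewrite rmorph0.
by rewrite !mulr1n rev_ordK rmorphM rmorphB /= conjCi !rmorph_nat mulNr -mulrN opprB.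
Qed.
End FlipAdjoint.

(** * Small perturbations along polynomial paths *)

Section SmallMatrices.
Context {R : realType}.
Local Notation C := R[i].
Local Notation normc := Normc.normc.

Lemma normc_ge0 (z : C) : 0 <= normc z.
Proof. by case: z => a b; apply: sqrtr_ge0. Qed.

Lemma small_spectral_norm n (eps : R) : 0 < eps ->
  exists2 delta, 0 < delta &
    forall M : 'M[C]_n,
      (forall i j, normc (M i j) <= delta) -> spectral_norm M < eps.
Proof.
move=> eps_gt0; set d := eps / (n ^ 2).+1%:R.
have d_gt0 : 0 < d by rewrite divr_gt0 ?ltr0n.
have lt_d : (n ^ 2)%:R * d < eps.
  by rewrite mulrA ltr_pdivrMr ?ltr0n // mulrC ltr_pM2l // ltr_nat.
clearbody d; exists d => // M Mle.
apply: le_lt_trans lt_d.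
  apply: sup_le_ub.
    exists (norm2 (M *m 0)), 0 => //=.
    by rewrite /norm2 big1 ?sqrtr0 // => i _; rewrite mxE Normc.normc0 expr0n.
  move=> _ [x /= x1 <-].
  have xle i : normc (x i 0) <= 1.
    apply: le_trans x1.
    rewrite -[leLHS]ger0_norm ?normc_ge0 // -sqrtr_sqr ler_wsqrtr //.
    by rewrite (bigD1 i) //= lerDl sumr_ge0 // => k _; apply: sqr_ge0.
  have Mx i : normc ((M *m x) i 0) <= n%:R * d.
    rewrite mxE.
    apply: (@le_trans _ _ (\sum_j normc (M i j * x j 0))).
      elim/big_ind2 : _ => [|a b c e ab ce|//]; first by rewrite Normc.normc0.
      by apply: le_trans (lerD ab ce); apply: le_normcD.
    rewrite mulr_natl -[n in leRHS]card_ord -sumr_const ler_sum // => j _.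
    rewrite Normc.normcM; apply: le_trans (Mle i j).
    by rewrite ler_piMr ?normc_ge0.
  have nd_ge0 : 0 <= (n ^ 2)%:R * d by rewrite mulr_ge0 // ltW.
  rewrite -[leRHS]ger0_norm // -sqrtr_sqr ler_wsqrtr //.
  apply: (@le_trans _ _ (\sum_(i < n) (n%:R * d) ^+ 2)).
    apply: ler_sum => i _; rewrite ler_sqr ?nnegrE ?normc_ge0 //.
    by rewrite mulr_ge0 // ltW.
  rewrite sumr_const card_ord -[leLHS]mulr_natl !exprMn mulrA.
  rewrite ler_wpM2r ?sqr_ge0 // -!natrX -natrM ler_nat -expnM.
  by case: (n) => // m; rewrite -expnS leq_pexp2l.
Qed.

Lemma polynomial_lipschitz (p : {poly C}) :
  exists L : R, forall s : R, 0 < s <= 1 -> normc (p.[s%:C] - p.[0]) <= L * s.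
Proof.
have normc_real (s : R) : 0 < s <= 1 -> normc s%:C = s.
  by case/andP=> s_gt0 _; rewrite /= expr0n addr0 sqrtr_sqr gtr0_norm.
have bounded (q : {poly C}) :
    exists L : R, forall s : R, 0 < s <= 1 -> normc q.[s%:C] <= L.
  elim/poly_ind: q => [|q a [L qL]].
    by exists 0 => s _; rewrite horner0 Normc.normc0.
  exists (L + normc a) => s s01; rewrite hornerMXaddC.
  apply: le_trans (le_normcD _ _) _; rewrite lerD2r Normc.normcM.
  apply: le_trans (qL s s01); rewrite normc_real //.
  by rewrite ler_piMr ?normc_ge0 //; case/andP: s01.
elim/poly_ind: p => [|p a _].
  by exists 0 => s _; rewrite !horner0 subrr Normc.normc0 mul0r.
have [L pL] := bounded p; exists L => s s01.
rewrite !hornerMXaddC mulr0 add0r addrK Normc.normcM.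
by rewrite normc_real // ler_wpM2r ?pL //; case/andP: s01 => /ltW.
Qed.

(** Otherwise all of the numbers [d / (k + 2)] would be roots of [f]. *)
Lemma exists_small_nonroot (f : {poly C}) (d : R) : f != 0 -> 0 < d ->
  exists2 s : R, 0 < s < d & ~~ root f s%:C.
Proof.
move=> f_neq0 d_gt0; apply: contrapT => no_s.
pose t k : R := d / k.+2%:R.
have t_itv k : 0 < t k < d.
  by rewrite divr_gt0 ?ltr0n // ltr_pdivrMr ?ltr0n // ltr_pMr // ltr1n.
pose ts := [seq (t k)%:C | k <- iota 0 (size f)].
have root_ts : all (root f) ts.
  apply/allP => _ /mapP[k _ ->]; apply/negPn/negP => tk.
  by apply: no_s; exists (t k).
have uniq_ts : uniq ts.
  rewrite map_inj_uniq ?iota_uniq // => j k /complexI.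
  by move=> /(mulfI (lt0r_neq0 d_gt0)) /invr_inj /eqP; rewrite eqr_nat => /eqP[].
have := max_poly_roots f_neq0 root_ts uniq_ts.
by rewrite size_map size_iota ltnn.
Qed.

(** The entries of a polynomial path are Lipschitz at [0], so a whole interval
    of parameters meets the bound on the distance, and it contains a parameter
    that is not a root of [f]. *)
Lemma small_path_parameter {n} (P : 'M[{poly C}]_n) (f : {poly C}) (eps : R) :
  f != 0 -> 0 < eps ->
  exists s : R, ~~ root f s%:C /\
    forall i j, normc (map_mx (horner_eval s%:C) P i j -
                       map_mx (horner_eval 0) P i j) <= eps.
Proof.
move=> f_neq0 eps_gt0.
have [L LP] : exists L : 'I_n * 'I_n -> R, forall ij s, 0 < s <= 1 ->
    normc ((P ij.1 ij.2).[s%:C] - (P ij.1 ij.2).[0]) <= L ij * s.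
  by apply: (fin_all_exists (fun ij => polynomial_lipschitz (P ij.1 ij.2))).
pose B := 1 + \sum_ij `|L ij|.
have B_gt0 : 0 < B by rewrite ltr_pwDl // sumr_ge0.
have [|s /andP[s_gt0 s_lt] fs] := exists_small_nonroot f (Num.min 1 (eps / B)) f_neq0.
  by rewrite lt_min ltr01 divr_gt0.
exists s; split=> // i j; rewrite !mxE !horner_evalE.
move: s_lt; rewrite lt_min => /andP[s_lt1 s_ltB].
have := LP (i, j) s; rewrite s_gt0 ltW //= => /(_ isT) /le_trans; apply.
apply: le_trans (_ : B * s <= _); last by rewrite mulrC -ler_pdivlMr // ltW.
rewrite ler_wpM2r ?(ltW s_gt0) //.
apply: le_trans (ler_norm _) _; rewrite /B (bigD1 (i, j)) //= addrCA lerDl.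
by rewrite addr_ge0 // sumr_ge0.
Qed.
End SmallMatrices.

(** * The two perturbations *)

(** The self-adjoint elements of the commutant of [S] are a real form of it, and
    a nonzero polynomial cannot vanish identically on a real form. *)
Lemma exists_cyclic_selfadjoint {R : realType} {n} (S : 'M[R[i]]_n.+1) :
  flip_adjoint S = - S ->
  exists M v, [/\ flip_adjoint M = M, S *m M = M *m S & cyclic_vector M v].
Proof.
move=> SS; have [N [v [SN cycN]]] := exists_commuting_cyclic S.
have SN' : S *m flip_adjoint N = flip_adjoint N *m S.
  apply: oppr_inj; rewrite -mulNmx -mulmxN -SS -!flip_adjointM.
  by rewrite SN.
pose X := 2^-1 *: (N + flip_adjoint N).
pose Y := - (2^-1 * 'i) *: (N - flip_adjoint N).
have XX : flip_adjoint X = X.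
  by rewrite flip_adjointZ flip_adjointD flip_adjointK addrC fmorphV rmorph_nat.
have YY : flip_adjoint Y = Y.
  rewrite /Y flip_adjointZ flip_adjointD flip_adjointN flip_adjointK.
  rewrite -[flip_adjoint _ - _]opprB.
  by rewrite !rmorphN rmorphM /= fmorphV rmorph_nat conjCi mulrN opprK scalerN scaleNr.
have defN : X + 'i *: Y = N.
  rewrite scalerA mulrN mulrCA -expr2 sqrCi mulrN1 opprK -scalerDr addrACA subrr addr0.
  by rewrite scalerDr -scalerDl -[2^-1]div1r -splitr scale1r.
have [f f_neq0 fP] : exists2 f : {poly R[i]}, f != 0 &
    forall s, ~~ root f s -> cyclic_vector (X + s *: Y) v.
  by apply: (cyclic_vector_line _ _ _ 'i); rewrite defN.
have [s _ /fP cyc_s] := exists_small_nonroot f 1 f_neq0 ltr01.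
exists (X + s%:C *: Y), v; split=> //; first exact: flip_adjoint_real_line.
have SX : S *m X = X *m S by rewrite -scalemxAr -scalemxAl mulmxDr mulmxDl SN SN'.
have SY : S *m Y = Y *m S by rewrite -scalemxAr -scalemxAl mulmxBr mulmxBl SN SN'.
by clearbody X Y; rewrite mulmxDr mulmxDl -scalemxAr -scalemxAl SX SY.
Qed.

(** Only the self-adjoint part of [A] moves, along the segment to a cyclic
    self-adjoint matrix commuting with the anti-self-adjoint part. *)
Lemma approx_by_polynomial_in_selfadjoint {R : realType} {n}
    (A : 'M[R[i]]_n.+1) eps :
  flip_normal A -> 0 < eps ->
  exists H q, flip_adjoint H = H /\
    forall i j, Normc.normc ((horner_mx H q - A) i j) <= eps.
Proof.
move=> nA eps_gt0.
pose H := 2^-1 *: (A + flip_adjoint A); pose S := 2^-1 *: (A - flip_adjoint A).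
have HH : flip_adjoint H = H.
  by rewrite flip_adjointZ flip_adjointD flip_adjointK addrC fmorphV rmorph_nat.
have SS : flip_adjoint S = - S.
  rewrite flip_adjointZ flip_adjointD flip_adjointN flip_adjointK.
  rewrite -[flip_adjoint _ - _]opprB.
  by rewrite fmorphV rmorph_nat scalerN.
have SH : S *m H = H *m S.
  rewrite -!scalemxAr -!scalemxAl; congr (_ *: (_ *: _)).
  by rewrite mulmxBl mulmxBr !mulmxDr !mulmxDl nA.
have defA : H + S = A.
  rewrite -scalerDr addrACA subrr addr0.
  by rewrite scalerDr -scalerDl -[2^-1]div1r -splitr scale1r.
clearbody H S; have [M [v [MM SM cycM]]] := exists_cyclic_selfadjoint S SS.
have [f f_neq0 fP] : exists2 f : {poly R[i]}, f != 0 &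
    forall s, ~~ root f s -> cyclic_vector (H + s *: (M - H)) v.
  by apply: (cyclic_vector_line _ _ _ 1); rewrite scale1r addrC subrK.
have [t [/fP cyc_t t_small]] :=
  small_path_parameter (line_mx H (M - H)) f eps f_neq0 eps_gt0.
pose Ht := H + t%:C *: (M - H).
have HtHt : flip_adjoint Ht = Ht.
  by apply: flip_adjoint_real_line; rewrite // flip_adjointD flip_adjointN MM HH.
have AtHt : (Ht + S) *m Ht = Ht *m (Ht + S).
  rewrite [LHS]mulmxDl [RHS]mulmxDr; congr (_ + _).
  by rewrite [LHS]mulmxDr [RHS]mulmxDl -scalemxAr -scalemxAl mulmxBr mulmxBl SH SM.
have [q qE] := commute_cyclic_horner _ _ _ cyc_t AtHt.
exists Ht, q; split=> // i j.
have -> : (horner_mx Ht q - A) i j = Ht i j - H i j.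
  by rewrite -qE -defA !mxE; ring.
by have := t_small i j; rewrite !map_line_mx scale0r addr0.
Qed.

(** Moving [H] alone would not do, since [q] may take the same value at distinct
    eigenvalues; [q] moves towards ['X] at the same time. *)
Lemma approx_distinct_eigenvalues {R : realType} {n} (H : 'M[R[i]]_n.+1) q eps :
  flip_adjoint H = H -> 0 < eps ->
  exists Ahat : 'M[R[i]]_n.+1,
    [/\ flip_normal Ahat, simple_spectrum_det Ahat != 0 &
        forall i j, Normc.normc ((Ahat - horner_mx H q) i j) <= eps].
Proof.
move=> HH eps_gt0; pose D : 'M[R[i]]_n.+1 := diag_mx flip_diag.
pose Hs := line_mx H (D - H).
(* The path with parameter ['X], and below its value at [s]. *)
pose Z := (1 - 'X) *: horner_mx Hs (map_poly polyC q) + 'X *: Hs.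
pose Hc s := H + s *: (D - H).
pose qs s := (1 - s) *: q + s *: 'X.
have ZE s : map_mx (horner_eval s) Z = horner_mx (Hc s) (qs s).
  rewrite map_mxD !map_mxZ map_horner_mx map_line_mx -/(Hc s) -map_poly_comp.
  rewrite /= /horner_eval hornerD hornerN hornerX hornerC.
  rewrite /qs rmorphD /= -!mul_polyC !rmorphM /= !horner_mx_C horner_mx_X.
  rewrite -!mulmxE !mul_scalar_mx; congr (_ *: horner_mx _ _ + _).
  by rewrite map_poly_id // => c _ /=; rewrite hornerC.
pose f := simple_spectrum_det Z.
have fE s : f.[s] = simple_spectrum_det (horner_mx (Hc s) (qs s)).
  by rewrite -ZE -map_simple_spectrum_det.
have f_neq0 : f != 0.
  have : f.[1] != 0.
    rewrite fE /Hc /qs subrr scale0r add0r !scale1r horner_mx_X addrC subrK.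
    exact/simple_spectrum_det_diag/flip_diag_inj.
  by apply: contraNneq => ->; rewrite horner0.
have [s [fs s_small]] := small_path_parameter Z f eps f_neq0 eps_gt0.
exists (horner_mx (Hc s%:C) (qs s%:C)); split; last 1 first.
- move=> i j; have := s_small i j; rewrite !ZE [X in horner_mx X (qs 0)]/Hc /qs.
  by rewrite !scale0r !addr0 subr0 scale1r !mxE.
- apply: flip_normal_horner; apply: flip_adjoint_real_line => //.
  by rewrite flip_adjointD flip_adjointN HH flip_adjoint_diag.
- by rewrite -fE.
Qed.

Theorem theorem6 (R : realType) (n : nat) (A : 'M[R[i]]_n) (eps : R)
    (hA : flip_normal A) (heps : 0 < eps) :
  exists Ahat : 'M[R[i]]_n,
    [/\ flip_normal Ahat,
        (exists s : seq R[i],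
           [/\ uniq s, size s = n &
               forall z : R[i], (z \in s) = eigenvalue Ahat z])
      & spectral_norm (A - Ahat) < eps].
Proof.
have [d d_gt0 small] := small_spectral_norm n eps heps.
case: n => [|n] in A hA small *.
  exists A; split=> //; last by apply: small => -[].
  exists [::]; split=> // z; apply/esym/negbTE/negP => /eigenvalueP[v _].
  by rewrite thinmx0 eqxx.
have d2_gt0 : 0 < d / 2 by rewrite divr_gt0.
have [H [q [HH A_near]]] :=
  approx_by_polynomial_in_selfadjoint A (d / 2) hA d2_gt0.
have [Ahat [nAhat dAhat Ahat_near]] :=
  approx_distinct_eigenvalues H q (d / 2) HH d2_gt0.
exists Ahat; split=> //; first exact: distinct_eigenvalues.
apply: small => i j; rewrite -normcN.
have -> : - (A - Ahat) i j =
    (Ahat - horner_mx H q) i j + (horner_mx H q - A) i j.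
  by rewrite !mxE; ring.
by apply: le_trans (le_normcD _ _) _; rewrite [d]splitr lerD.
Qed.
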